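(* For the subsampling-with-replacement estimator $$\tilde\theta_{s_n,R}=\arg\max_\theta\sum_{i=1}^{s_n}\frac{m(Z_i^*,\theta)}{ns_n\pi_{n,i}^*},$$ the L-optimal subsampling probabilities with $L=\ddot M_n(\hat\theta_n)$, that is, those that minimize $\mathrm{tr}\{\Lambda_{n,R}(\hat\theta_n)\}$, where $$\Lambda_{n,R}(\theta)=\frac1{n^2}\sum_{i=1}^n\frac{\dot m(Z_i,\theta)\dot m^{T}(Z_i,\theta)}{\pi_{n,i}},$$ are $$\pi_{n,Ri}^{\mathrm{opt}}=\frac{\|\dot m(Z_i,\hat\theta_n)\|}{\sum_{j=1}^n\|\dot m(Z_j,\hat\theta_n)\|},\qquad i=1,\dots,n.$$
   Context: The full data $Z_1,\dots,Z_n$ are independent observations from the distribution of $Z$; $m(Z,\theta)$ is a real-valued function of $\theta\in\mathbb R^d$ with gradient $\dot m$ and Hessian $\ddot m$ with respect to $\theta$; $\hat\theta_n$ is the maximizer of $M_n(\theta)=\frac1n\sum_{i=1}^n m(Z_i,\theta)$, and $\ddot M_n(\theta)=\frac1n\sum_{i=1}^n\ddot m(Z_i,\theta)$. $\|\cdot\|$ is the Euclidean norm and $\mathrm{tr}$ is the trace. A subsampling distribution is $\{\pi_{n,i}\}_{i=1}^n$ with $\pi_{n,i}>0$ and $\sum_{i=1}^n\pi_{n,i}=1$. In subsampling with replacement, $Z_1^*,\dots,Z_{s_n}^*$ are $s_n$ draws made independently (given the full data) from $Z_1,\dots,Z_n$ with probabilities $\{\pi_{n,i}\}_{i=1}^n$,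 and $\pi_{n,1}^*,\dots,\pi_{n,s_n}^*$ are the subsampling probabilities corresponding to the drawn points. The (scaled) asymptotic variance matrix of $\tilde\theta_{s_n,R}$ as an approximation of $\hat\theta_n$, given the full data, is $V_{n,R}(\hat\theta_n)=\ddot M_n^{-1}(\hat\theta_n)\Lambda_{n,R}(\hat\theta_n)\ddot M_n^{-1}(\hat\theta_n)$. For a matrix $L$, the L-optimality criterion is to choose $\{\pi_{n,i}\}_{i=1}^n$ to minimize $\mathrm{tr}\{LV_{n,R}(\hat\theta_n)L^{T}\}$; for $L=\ddot M_n(\hat\theta_n)$ this amounts to minimizing $\mathrm{tr}\{\Lambda_{n,R}(\hat\theta_n)\}$.
   Formalization: Minimality is claimed when all gradients at the full-data estimator are nonzero; otherwise some optimal probability is 0, which a subsampling distribution forbids. If some but not all vanish, the formula is shown to give the infimum of the criterion (0/0 read as 0). *)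

(* Defs.v *)
From HB Require Import structures.
From mathcomp Require Import all_boot all_order all_algebra.
From mathcomp Require Import all_classical all_reals all_analysis.

Set Implicit Arguments.
Unset Strict Implicit.
Unset Printing Implicit Defensive.

Import Order.TTheory GRing.Theory Num.Theory.
Import numFieldNormedType.Exports.

Local Open Scope classical_set_scope.
Local Open Scope ring_scope.

Definition mutually_independent (R : realType) (dO dT : measure_display)
    (Omega : measurableType dO) (T : measurableType dT)
    (P : probability Omega R) (n : nat) (Z : 'I_n -> {RV P >-> T}) : Prop :=
  forall (J : {set 'I_n}) (A : 'I_n -> set T),
    (forall i, measurable (A i)) ->
    P (\bigcap_(i in [set` J]) (Z i @^-1` A i)) =
      (\prod_(i in J) P (Z i @^-1` A i))%E.

Definition has_law (R : realType) (dO dT : measure_display)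
    (Omega : measurableType dO) (T : measurableType dT)
    (P : probability Omega R) (X : {RV P >-> T}) (Q : probability T R) : Prop :=
  forall A : set T, measurable A -> distribution P X A = Q A.

Definition iid_sample (R : realType) (dO dT : measure_display)
    (Omega : measurableType dO) (T : measurableType dT)
    (P : probability Omega R) (n : nat) (Z : 'I_n -> {RV P >-> T})
    (Q : probability T R) : Prop :=
  mutually_independent Z /\ forall i, has_law (Z i) Q.

(* The library norm [`|x|] on matrices is the sup norm: it yields the same
   derivatives as the Euclidean norm, but not the same weights [pi_opt]. *)
Definition enorm (R : realType) (d : nat) (x : 'cV[R]_d) : R :=
  Num.sqrt (\sum_(i < d) x i 0 ^+ 2).

Definition gradient (R : realType) (d : nat) (f : 'cV[R]_d -> R)
    (t : 'cV[R]_d) : 'cV[R]_d :=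
  \col_(i < d) 'D_(delta_mx i 0) f t.

Definition hessian (R : realType) (d : nat) (f : 'cV[R]_d -> R)
    (t : 'cV[R]_d) : 'M[R]_d :=
  \matrix_(i < d, j < d) 'D_(delta_mx j 0) (fun u => gradient f u i 0) t.

Definition twice_differentiable (R : realType) (d : nat)
    (f : 'cV[R]_d -> R) : Prop :=
  forall t, differentiable f t /\ differentiable (gradient f) t.

Definition mean_objective (R : realType) (T : Type) (d n : nat)
    (m : T -> 'cV[R]_d -> R) (z : 'I_n -> T) (t : 'cV[R]_d) : R :=
  n%:R^-1 * \sum_(i < n) m (z i) t.

Definition mean_hessian (R : realType) (T : Type) (d n : nat)
    (m : T -> 'cV[R]_d -> R) (z : 'I_n -> T) (t : 'cV[R]_d) : 'M[R]_d :=
  n%:R^-1 *: \sum_(i < n) hessian (m (z i)) t.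

Definition is_maximizer (R : realType) (d : nat) (f : 'cV[R]_d -> R)
    (t : 'cV[R]_d) : Prop :=
  forall u, f u <= f t.

Definition subsampling_distribution (R : realType) (n : nat)
    (p : 'I_n -> R) : Prop :=
  (forall i, 0 < p i) /\ \sum_(i < n) p i = 1.

(* Where [p i = 0] the term is 0, since [0^-1 = 0]. This happens only when the
   formula is evaluated at a weight vector that is not a subsampling
   distribution, such as [pi_opt] when some (not all) gradients vanish; the
   mathematical convention 0/0 = 0 is then the relevant one. *)
Definition LambdaR (R : realType) (T : Type) (d n : nat)
    (m : T -> 'cV[R]_d -> R) (z : 'I_n -> T) (t : 'cV[R]_d)
    (p : 'I_n -> R) : 'M[R]_d :=
  (n%:R ^+ 2)^-1 *:
    \sum_(i < n) (p i)^-1 *: (gradient (m (z i)) t *m (gradient (m (z i)) t)^T).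

(* The asymptotic variance is only meaningful for an invertible
   [mean_hessian m z t]: [invmx] is the identity on singular matrices. *)
Definition asymptotic_varianceR (R : realType) (T : Type) (d n : nat)
    (m : T -> 'cV[R]_d -> R) (z : 'I_n -> T) (t : 'cV[R]_d)
    (p : 'I_n -> R) : 'M[R]_d :=
  invmx (mean_hessian m z t) *m LambdaR m z t p
    *m invmx (mean_hessian m z t).

Definition L_criterion (R : realType) (T : Type) (d n k : nat)
    (L : 'M[R]_(k, d)) (m : T -> 'cV[R]_d -> R) (z : 'I_n -> T)
    (t : 'cV[R]_d) (p : 'I_n -> R) : R :=
  \tr (L *m asymptotic_varianceR m z t p *m L^T).

Definition optimal_subsampling (R : realType) (n : nat)
    (C : ('I_n -> R) -> R) (p : 'I_n -> R) : Prop :=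
  subsampling_distribution p /\
  forall q, subsampling_distribution q -> C p <= C q.

Definition L_optimal (R : realType) (T : Type) (d n k : nat)
    (L : 'M[R]_(k, d)) (m : T -> 'cV[R]_d -> R) (z : 'I_n -> T)
    (t : 'cV[R]_d) (p : 'I_n -> R) : Prop :=
  optimal_subsampling (L_criterion L m z t) p.

Definition pi_opt (R : realType) (T : Type) (d n : nat)
    (m : T -> 'cV[R]_d -> R) (z : 'I_n -> T) (t : 'cV[R]_d) (i : 'I_n) : R :=
  enorm (gradient (m (z i)) t) / \sum_(j < n) enorm (gradient (m (z j)) t).

(* Main.v *)
Require Import Defs.
From HB Require Import structures.
From mathcomp Require Import all_boot all_order all_algebra.
From mathcomp Require Import all_classical all_reals all_analysis.
From mathcomp Require Import ring lra.

Import Order.TTheory GRing.Theory Num.Theory.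
Import numFieldNormedType.Exports.

Local Open Scope classical_set_scope.
Local Open Scope ring_scope.

(** Write g_i for the Euclidean norm of the i-th gradient and G for the sum of
    the g_i.  The trace of x x^T is the squared norm of x, so the trace of
    Lambda is n^-2 times the sum of the g_i^2 / p_i ([mxtrace_LambdaR]).  For a
    subsampling distribution p this sum exceeds G^2 by exactly the sum of the
    (g_i - p_i G)^2 / p_i ([sum_sqr_div_gap]), an explicit remainder in the
    Cauchy-Schwarz inequality.  Hence G^2 is a lower bound, attained only where
    p_i = g_i / G.

    If some g_i vanish, then g_i / G is not a subsampling distribution, but the
    criterion, read with 0/0 = 0, still takes the value G^2 there.  Mixing a
    small amount e of the uniform distribution into g_i / G gives genuine
    distributions with value at most G^2 / (1 - e) ([sum_sqr_div_mix]), so G^2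
    is the infimum ([inf_sum_sqr_div]).

    The L-criterion for L the mean Hessian M is the trace of
    M M^-1 Lambda M^-1 M^T.  It equals the trace of Lambda because M is
    symmetric ([mean_hessian_tr]).  The second derivatives are not assumed
    continuous, so this symmetry is the strong form of Schwarz's theorem: it
    suffices that the first partial derivatives are differentiable at the point
    ([derive_comm]).  The proof shows that the second difference of f over the
    parallelogram spanned by h u and h v, divided by h^2, tends to
    D_v (D_u f); the second difference is symmetric in u and v. *)

(** * Symmetry of second derivatives *)

Lemma is_derive_along_line (R : realType) (V : normedModType R) (f : V -> R)
    (u w : V) (s : R) :
  differentiable f (s *: u + w) ->
  is_derive s 1 (fun x : R => f (x *: u + w)) ('D_u f (s *: u + w)).
Proof.
move=> df.
have E : (fun h : R => h^-1 *: (((fun x : R => f (x *: u + w)) \o shift s) (h *: 1)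
           - f (s *: u + w))) =
    (fun h : R => h^-1 *: ((f \o shift (s *: u + w)) (h *: u) - f (s *: u + w))).
  by apply/funext => h /=; rewrite [h *: 1]mulr1 scalerDl addrA.
split; first by rewrite /derivable E; exact: diff_derivable.
by rewrite /derive E.
Qed.

Lemma differentiable_linear_approx (R : realType) (V : normedModType R)
    (g : V -> R) (t : V) (e : R) : differentiable g t -> 0 < e ->
  exists2 r : R, 0 < r & forall k : V, `|k| < r ->
    `|g (k + t) - g t - 'D_k g t| <= e * `|k|.
Proof.
move=> dg e0; have /diff_locally/eqaddoP/(_ e e0) := dg.
move=> /nbhs_normP[r /= r0 H]; exists r => // k kr.
rewrite (deriveE _ dg) -addrA -opprD; apply: H => /=.
by rewrite /ball_ /= sub0r normrN.
Qed.

(** By the mean value theorem applied to s |-> f(su + hv + t) - f(su + t), the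
    second difference is h times an increment of g = D_u f between two points at
    distance O(h) from t.  Both values of g are then replaced by the first-order
    expansion of g at t, and not by derivatives of g at intermediate points:
    that is why differentiability of g at t alone is enough. *)
Lemma second_difference_approx (R : realType) (V : normedModType R)
    (f : V -> R) (t u v : V) (e : R) :
  (forall x, differentiable f x) -> differentiable ('D_u f) t -> 0 < e ->
  exists2 r : R, 0 < r & forall h : R, 0 < h -> h < r ->
    `|f (h *: u + h *: v + t) - f (h *: u + t) - f (h *: v + t) + f t
       - 'D_v ('D_u f) t * h ^+ 2| <= e * h ^+ 2.
Proof.
move=> df dg e0; set g := 'D_u f in dg *.
(* The displacements used below have norm at most h * C; the summand 1 makes
   C positive even when u = v = 0. *)
pose C := `|u| + `|v| + 1.
have C0 : 0 < C by rewrite /C ltr_wpDl// addr_ge0.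
have [r r0 Hr] := differentiable_linear_approx R V g t (e / (2 * C)) dg
  (divr_gt0 e0 (mulr_gt0 (ltr0Sn _ 1) C0)).
exists (r / C) => [|h h0]; first exact: divr_gt0.
rewrite ltr_pdivlMr// => hr.
pose phi (s : R) : R := f (s *: u + (h *: v + t)) - f (s *: u + t).
pose dphi (s : R) : R := g (s *: u + (h *: v + t)) - g (s *: u + t).
have dphiP (s : R) : is_derive s 1 phi (dphi s).
  by apply: is_deriveB; exact: is_derive_along_line.
have [c /[!in_itv]/= /andP[c0 ch]] : exists2 c, c \in `]0, h[%R &
    phi h - phi 0 = dphi c * (h - 0).
  apply: MVT => // s; apply: derivable_within_continuous => x _.
  exact: ex_derive.
rewrite subr0 {1 2}/phi !scale0r !add0r => E.
pose k1 := c *: u + h *: v; pose k2 := c *: u.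
have k2C : `|k2| <= h * C.
  rewrite normrZ (gtr0_norm c0); apply: ler_pM => //; first exact: ltW.
    exact: ltW.
  by rewrite /C -addrA lerDl addr_ge0.
have k1C : `|k1| <= h * C.
  rewrite (le_trans (ler_normD _ _))// !normrZ (gtr0_norm c0) (gtr0_norm h0).
  by have := ler_wpM2r (normr_ge0 u) (ltW ch); rewrite /C; lra.
have A1 := Hr _ (le_lt_trans k1C hr).
have A2 := Hr _ (le_lt_trans k2C hr).
have D12 : 'D_k1 g t = 'D_k2 g t + h * 'D_v g t.
  by rewrite !(deriveE _ dg) /k1 linearD; congr (_ + _); exact: linearZ.
have -> : f (h *: u + h *: v + t) - f (h *: u + t) - f (h *: v + t) + f t
       - 'D_v g t * h ^+ 2 =
   h * ((g (k1 + t) - g t - 'D_k1 g t) - (g (k2 + t) - g t - 'D_k2 g t)).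
  rewrite D12 -[h *: u + h *: v + t]addrA.
  have -> : g (k1 + t) = dphi c + g (k2 + t) by rewrite /dphi subrK /k1 -addrA.
  (* Stated for bare real numbers, so that ring is not confronted with the
     values of f and g, whose types are real only up to conversion. *)
  have alg (f1 f2 f3 f0 y a b g2 g0 : R) : f1 - f2 - (f3 - f0) = y * h ->
      f1 - f2 - f3 + f0 - b * h ^+ 2 =
      h * ((y + g2 - g0 - (a + h * b)) - (g2 - g0 - a)).
    move=> fE; have -> : f1 - f2 - f3 + f0 = f1 - f2 - (f3 - f0) by ring.
    by rewrite fE; ring.
  exact: alg.
rewrite normrM (gtr0_norm h0) expr2 mulrA (mulrC e) -mulrA ler_pM2l//.
apply: (le_trans (ler_normB _ _)); apply: (le_trans (lerD A1 A2)).
rewrite -mulrDr; apply: (@le_trans _ _ (e / (2 * C) * (h * C + h * C))).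
  by rewrite ler_pM2l ?lerD// divr_gt0// mulr_gt0.
by rewrite le_eqVlt; apply/orP; left; apply/eqP; field; exact: lt0r_neq0.
Qed.

(** Schwarz's theorem without continuity of the second derivatives: both sides
    are the limit of the same normalized second difference, so at a scale h
    where both approximations hold with error a quarter of their distance, that
    distance is at most half of itself. *)
Lemma derive_comm (R : realType) (V : normedModType R) (f : V -> R) (t u v : V) :
  (forall x, differentiable f x) ->
  differentiable ('D_u f) t -> differentiable ('D_v f) t ->
  'D_v ('D_u f) t = 'D_u ('D_v f) t.
Proof.
have no_half (x : R) : 0 < x / 4 -> x <= x / 4 + x / 4 -> False by lra.
move=> df du dv; apply/eqP; rewrite -subr_eq0 -normr_eq0 -[_ == _]negbK.
apply/negP => ne; set A := 'D_v _ _ in ne; set B := 'D_u _ _ in ne.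
have e0 : 0 < `|A - B| / 4 by rewrite divr_gt0// lt_def ne normr_ge0.
have [r1 r10 H1] := second_difference_approx R V f t u v _ df du e0.
have [r2 r20 H2] := second_difference_approx R V f t v u _ df dv e0.
pose h := Num.min r1 r2 / 2.
have m0 : 0 < Num.min r1 r2 by rewrite lt_min r10.
have h0 : 0 < h by rewrite divr_gt0.
have hm : h < Num.min r1 r2 by rewrite /h ltr_pdivrMr// ltr_pMr// ltr1n.
move: hm; rewrite lt_min => /andP[hr1 hr2].
have := lerD (H1 h h0 hr1) (H2 h h0 hr2).
rewrite -/A -/B [h *: v + h *: u]addrC.
set S := f _ - _ - _ + _; set S' := f _ - _ - _ + _.
have -> : S' = S by rewrite /S /S'; lra.
move=> K; have := le_trans (ler_normB _ _) K.
have -> : S - A * h ^+ 2 - (S - B * h ^+ 2) = - ((A - B) * h ^+ 2) by ring.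
rewrite normrN normrM (gtr0_norm (exprn_gt0 2 h0)) -mulrDl ler_pM2r ?exprn_gt0//.
by apply: no_half.
Qed.

Lemma hessian_tr (R : realType) (d : nat) (f : 'cV[R]_d -> R) (t : 'cV[R]_d) :
  twice_differentiable f -> (hessian f t)^T = hessian f t.
Proof.
move=> df; apply/matrixP => i j; rewrite !mxE.
have gE k : (fun u => gradient f u k 0) = 'D_(delta_mx k 0) f.
  by apply/funext => u; rewrite mxE.
have dg k : differentiable ('D_(delta_mx k 0) f) t.
  rewrite -gE; apply: (@differentiable_comp _ _ _ _ (gradient f)
    (fun M : 'cV[R]_d => M k 0)); last exact: differentiable_coord.
  by have [] := df t.
by rewrite !gE; apply: derive_comm => // x; have [] := df x.
Qed.

Lemma mean_hessian_tr (R : realType) (T : Type) (d n : nat)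
    (m : T -> 'cV[R]_d -> R) (z : 'I_n -> T) (t : 'cV[R]_d) :
  (forall x, twice_differentiable (m x)) ->
  (mean_hessian m z t)^T = mean_hessian m z t.
Proof.
move=> dm; rewrite /mean_hessian linearZ /= raddf_sum /=.
by under eq_bigr do rewrite hessian_tr//.
Qed.

(** The transposed factor M^T on the right cancels M^-1 only because the Hessian
    is symmetric; this is where twice differentiability enters. *)
Lemma L_criterion_hessian (R : realType) (T : Type) (d n : nat)
    (m : T -> 'cV[R]_d -> R) (z : 'I_n -> T) (t : 'cV[R]_d) (p : 'I_n -> R) :
  (forall x, twice_differentiable (m x)) -> mean_hessian m z t \in unitmx ->
  L_criterion (mean_hessian m z t) m z t p = \tr (LambdaR m z t p).
Proof.
move=> dm uM; rewrite /L_criterion mean_hessian_tr// /asymptotic_varianceR.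
by rewrite -mulmxA mulmxKV// mulKVmx.
Qed.

(** * The trace criterion as a weighted sum *)

Lemma enorm_ge0 (R : realType) (d : nat) (x : 'cV[R]_d) : 0 <= enorm x.
Proof. exact: sqrtr_ge0. Qed.

Lemma enorm_gt0 (R : realType) (d : nat) (x : 'cV[R]_d) : x <> 0 -> 0 < enorm x.
Proof.
move=> x0; rewrite lt_def enorm_ge0 andbT; apply/negP => /eqP.
have s0 : 0 <= \sum_(i < d) x i 0 ^+ 2 by apply: sumr_ge0 => i _; exact: sqr_ge0.
move=> /eqP; rewrite sqrtr_eq0 => s0'.
have /eqP : \sum_(i < d) x i 0 ^+ 2 = 0 by apply/eqP; rewrite eq_le s0' s0.
rewrite psumr_eq0 => [/allP H|i _]; last exact: sqr_ge0.
apply: x0; apply/matrixP => i j; rewrite ord1 mxE; apply/eqP.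
by rewrite -sqrf_eq0; apply: H; rewrite mem_index_enum.
Qed.

Lemma mxtrace_mul_tr (R : realType) (d : nat) (x : 'cV[R]_d) :
  \tr (x *m x^T) = enorm x ^+ 2.
Proof.
rewrite sqr_sqrtr; last by apply: sumr_ge0 => i _; exact: sqr_ge0.
by apply: eq_bigr => i _; rewrite !mxE big_ord1 mxE expr2.
Qed.

Lemma mxtrace_LambdaR (R : realType) (T : Type) (d n : nat)
    (m : T -> 'cV[R]_d -> R) (z : 'I_n -> T) (t : 'cV[R]_d) (p : 'I_n -> R) :
  \tr (LambdaR m z t p) =
  (n%:R ^+ 2)^-1 * \sum_(i < n) enorm (gradient (m (z i)) t) ^+ 2 / p i.
Proof.
rewrite /LambdaR mxtraceZ raddf_sum /=; congr (_ * _).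
by apply: eq_bigr => i _; rewrite mxtraceZ mxtrace_mul_tr mulrC.
Qed.

(** * Minimizing the weighted sum *)

Section weighted_sum.
Variables (R : realType) (n : nat) (g : 'I_n -> R).
Let G := \sum_(i < n) g i.
Let C (p : 'I_n -> R) := \sum_(i < n) g i ^+ 2 / p i.

(** Expanding the square, the cross terms add up to - 2 G^2 and the last terms
    to G^2, because p sums to 1. *)
Lemma sum_sqr_div_gap (p : 'I_n -> R) : subsampling_distribution p ->
  C p = G ^+ 2 + \sum_(i < n) (g i - p i * G) ^+ 2 / p i.
Proof.
move=> [p0 p1].
have -> : \sum_(i < n) (g i - p i * G) ^+ 2 / p i =
    \sum_(i < n) (g i ^+ 2 / p i - 2 * G * g i + G ^+ 2 * p i).
  by apply: eq_bigr => i _; field; exact: lt0r_neq0.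
rewrite big_split/= sumrB -!mulr_sumr p1 -/G -/(C p); ring.
Qed.

Lemma le_sum_sqr_div (p : 'I_n -> R) : subsampling_distribution p ->
  G ^+ 2 <= C p.
Proof.
move=> hp; rewrite (sum_sqr_div_gap _ hp) lerDl; apply: sumr_ge0 => i _.
by apply: divr_ge0; [exact: sqr_ge0|case: hp => + _ => /(_ i)/ltW].
Qed.

Lemma sum_sqr_div_min_eq (p : 'I_n -> R) : subsampling_distribution p ->
  C p <= G ^+ 2 -> forall i, g i = p i * G.
Proof.
move=> hp; rewrite (sum_sqr_div_gap _ hp) gerDl => le0 i; have [p0 _] := hp.
have t0 j : 0 <= (g j - p j * G) ^+ 2 / p j.
  by apply: divr_ge0; [exact: sqr_ge0|exact: ltW].
have /eqP : \sum_(j < n) (g j - p j * G) ^+ 2 / p j = 0.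
  by apply/eqP; rewrite eq_le le0 sumr_ge0.
rewrite psumr_eq0 => [/allP/(_ i)|//]; rewrite mem_index_enum => /(_ isT)/=.
rewrite mulf_eq0 sqrf_eq0 invr_eq0 (gt_eqF (p0 i)) orbF subr_eq0.
by move=> /eqP.
Qed.

Hypotheses (g_ge0 : forall i, 0 <= g i) (G_gt0 : 0 < G).

(** A term with g i = 0 has numerator 0 and contributes 0, which is also its
    share g i * G of G^2; so the value G^2 persists when g / G leaves the open
    simplex. *)
Lemma sum_sqr_div_normalized : C (fun i => g i / G) = G ^+ 2.
Proof.
rewrite expr2 [in LHS]/C {2}/G mulr_suml; apply: eq_bigr => i _.
have [->|gi0] := eqVneq (g i) 0; first by rewrite expr0n/= !mul0r.
by field; rewrite gi0 lt0r_neq0.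
Qed.

Lemma sum_normalized : \sum_(i < n) g i / G = 1.
Proof. by rewrite -mulr_suml divff// lt0r_neq0. Qed.

(** The witness is the mixture of g / G and the uniform distribution, with
    weights 1 - e and e.  Its entries are positive, and they are at least
    (1 - e) g i / G, which bounds each term of the sum. *)
Lemma sum_sqr_div_mix (e : R) : 0 < e < 1 ->
  exists2 p : 'I_n -> R, subsampling_distribution p & C p <= G ^+ 2 / (1 - e).
Proof.
move=> /andP[e0 e1].
have n0 : 0 < n%:R :> R.
  rewrite ltr0n lt0n; apply: contraTneq G_gt0 => n0.
  rewrite /G big1 ?ltxx// => i _.
  by have /lt0n_neq0/eqP := leq_ltn_trans (leq0n i) (ltn_ord i).
have e10 : 0 < 1 - e by rewrite subr_gt0.
exists (fun i => (1 - e) * (g i / G) + e / n%:R).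
  split=> [i|].
    rewrite ltr_wpDl ?divr_gt0// mulr_ge0// ?(ltW e10)// divr_ge0//.
    exact: ltW.
  rewrite big_split/= -mulr_sumr sum_normalized sumr_const card_ord.
  by rewrite -mulr_natr; field; exact: lt0r_neq0.
rewrite -sum_sqr_div_normalized /C mulr_suml; apply: ler_sum => i _.
have [->|gi0] := eqVneq (g i) 0; first by rewrite expr0n/= !mul0r.
have gi : 0 < g i by rewrite lt_def gi0/=.
rewrite -mulrA ler_wpM2l ?sqr_ge0// -invfM lef_pV2 ?posrE.
- by rewrite mulrC lerDl divr_ge0// ltW.
- by apply: addr_gt0; [apply: mulr_gt0 => //|]; exact: divr_gt0.
- by apply: mulr_gt0 => //; exact: divr_gt0.
Qed.

Lemma inf_sum_sqr_div (a : R) : 0 <= a ->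
  inf [set a * C p | p in @subsampling_distribution R n] = a * G ^+ 2.
Proof.
move=> a0; set E := [set _ | _ in _].
have lbE : lbound E (a * G ^+ 2).
  by move=> _ [p hp <-]; apply: ler_wpM2l => //; exact: le_sum_sqr_div.
have aG0 : 0 <= a * G ^+ 2 by rewrite mulr_ge0// sqr_ge0.
have infE (e : R) : 0 < e < 1 -> inf E <= a * G ^+ 2 / (1 - e).
  move=> e01; have [p hp le_p] := sum_sqr_div_mix _ e01.
  apply: (@le_trans _ _ (a * C p)).
    by apply: ge_inf; [exists (a * G ^+ 2)|exists p].
  by rewrite -mulrA; exact: ler_wpM2l.
apply/eqP; rewrite eq_le; apply/andP; split; last first.
  apply: lb_le_inf => //; have [|p hp _] := sum_sqr_div_mix 2^-1; last first.
    by exists (a * C p), p.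
  by apply/andP; split; lra.
(* If b < inf E, the choice of e for which (inf E) * (1 - e) is the midpoint of
   b and inf E contradicts infE. *)
rewrite leNgt; apply/negP => ltI; set b := a * G ^+ 2 in aG0 infE ltI.
have I0 : 0 < inf E by exact: le_lt_trans ltI.
pose e := (inf E - b) / (2 * inf E).
have e0 : 0 < e by rewrite divr_gt0 ?subr_gt0// mulr_gt0.
have e1 : e < 1.
  by rewrite ltr_pdivrMr ?mulr_gt0// mul1r mulr_natl mulr2n ltrBlDr ltr_wpDr// ltrDl.
have := infE e; rewrite e0 e1 => /(_ isT).
rewrite ler_pdivlMr ?subr_gt0//.
have -> : inf E * (1 - e) = (inf E + b) / 2 by rewrite /e; field; exact: lt0r_neq0.
by rewrite ler_pdivrMr// mulr_natr mulr2n lerD2r leNgt ltI.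
Qed.

Lemma optimal_sum_sqr_div (a : R) (p : 'I_n -> R) :
  0 < a -> (forall i, 0 < g i) ->
  optimal_subsampling (fun q => a * C q) p <-> p =1 (fun i => g i / G).
Proof.
move=> a0 gp; have hopt : subsampling_distribution (fun i => g i / G).
  by split=> [i|]; [exact: divr_gt0|exact: sum_normalized].
split=> [[hp pmin] i|/funext->]; last first.
  split=> // q hq; rewrite ler_pM2l// sum_sqr_div_normalized.
  exact: le_sum_sqr_div.
have := pmin _ hopt; rewrite ler_pM2l// sum_sqr_div_normalized => Cp.
by rewrite (sum_sqr_div_min_eq _ hp Cp i) mulfK// lt0r_neq0.
Qed.

End weighted_sum.

Theorem theorem3 (R : realType) (dO dT : measure_display)
    (Omega : measurableType dO) (T : measurableType dT)
    (P : probability Omega R) (Q : probability T R)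
    (d n : nat) (n_gt0 : (0 < n)%N)
    (Z : 'I_n -> {RV P >-> T}) (Z_iid : iid_sample Z Q)
    (m : T -> 'cV[R]_d -> R) (m_diff2 : forall x, twice_differentiable (m x))
    (theta_hat : Omega -> 'cV[R]_d)
    (theta_hat_max : forall w,
       is_maximizer (mean_objective m (fun i => Z i w)) (theta_hat w))
    (w : Omega) :
  let z := fun i : 'I_n => Z i w in
  let th := theta_hat w in
  let M2 := mean_hessian m z th in
  let trLambda := fun p : 'I_n -> R => \tr (LambdaR m z th p) in
  let popt := pi_opt m z th in
  ((forall i, gradient (m (z i)) th <> 0) ->
     (forall p, optimal_subsampling trLambda p <-> p =1 popt) /\
     (M2 \in unitmx -> forall p, L_optimal M2 m z th p <-> p =1 popt)) /\
  ((exists i, gradient (m (z i)) th <> 0) ->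
     [/\ forall i, 0 <= popt i,
         \sum_(i < n) popt i = 1,
         trLambda popt = inf [set trLambda p | p in @subsampling_distribution R n] &
         M2 \in unitmx ->
           L_criterion M2 m z th popt =
             inf [set L_criterion M2 m z th p | p in @subsampling_distribution R n]]).
Proof.
move=> z th M2 trLambda popt.
pose g i := enorm (gradient (m (z i)) th).
pose a : R := (n%:R ^+ 2)^-1.
have a_gt0 : 0 < a by rewrite invr_gt0 exprn_gt0// ltr0n.
have g_ge0 i : 0 <= g i by exact: enorm_ge0.
have trE : trLambda = (fun p => a * \sum_(i < n) g i ^+ 2 / p i).
  by apply/funext => p; exact: mxtrace_LambdaR.
have LE : M2 \in unitmx -> L_criterion M2 m z th = trLambda.
  by move=> uM; apply/funext => p; exact: L_criterion_hessian.
have G_gt0 : (exists i, gradient (m (z i)) th <> 0) -> 0 < \sum_(i < n) g i.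
  move=> [i gi]; rewrite (bigD1 i)//= ltr_pwDl ?sumr_ge0//.
  exact: enorm_gt0.
split=> [gn0|/G_gt0 G0].
  have G0 : 0 < \sum_(i < n) g i by apply: G_gt0; exists (Ordinal n_gt0).
  have opt p : optimal_subsampling trLambda p <-> p =1 popt.
    by rewrite trE; apply: optimal_sum_sqr_div => // i; exact: enorm_gt0.
  by split=> // uM p; rewrite /L_optimal LE.
have infE : trLambda popt =
    inf [set trLambda p | p in @subsampling_distribution R n].
  by rewrite trE inf_sum_sqr_div ?(ltW a_gt0)// sum_sqr_div_normalized.
split=> // [i||uM].
- by apply: divr_ge0; [exact: g_ge0|exact: ltW].
- exact: sum_normalized.
- by rewrite LE.
Qed.
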